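(* The Longest Forward Distance (LFD) algorithm for the sorting buffer problem has approximation ratio $\Omega(k^{1/3})$, where $k$ is the buffer size; that is, there are instances with arbitrarily large buffer size $k$ on which the number of color changes of LFD is at least $c\cdot k^{1/3}$ times the optimal number of color changes, for some absolute constant $c>0$.
   Context: Sorting buffer problem: the input is a sequence $\sigma$ of $n$ items, each item $i$ having a color $c(i)$, and a buffer capacity $k$. Items are moved one after another, in the order of $\sigma$, into a random-access buffer that can hold at most $k$ items. The buffer has no color initially. At any step a scheduling algorithm chooses a color $c$; then all items in the buffer with color $c$ are removed and processed by a single server; the next items of the sequence are moved into the freed space, and any new items of color $c$ are removed immediately, until no item of color $c$ remains in the buffer. Then a new color is chosen, and so on. The cost is the number of color changes, to be minimized. The LFD algorithm: whenever no item can be served without a color change, it chooses the color of the item $i$ in the buffer whose next occurrence $j>i$ in the sequence (the next item with the same color as $i$) is farthest in the future; if no later item with the same color as $i$ exists, this distance is infinity. *)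

(* Defs.v *)
From mathcomp Require Import all_boot.
From mathcomp Require boolp.

Set Implicit Arguments.
Unset Strict Implicit.
Unset Printing Implicit Defensive.

(* Colors are natural numbers; an input sequence is the list [sigma] of the
   colors of its items, and an item is its position in [sigma]. *)
Definition color := nat.
Definition item := nat.

Definition color_of (sigma : seq color) (i : item) : color := nth 0 sigma i.

(* Items in the buffer, and items not yet moved into it (in input order). *)
Definition state := (seq item * seq item)%type.

(* Moves items into [b] as long as there is room; an item of the active color
   [cur] is served at once and so never keeps a slot.  [cur] is [None] before
   the first choice. *)
Fixpoint load (k : nat) (sigma : seq color) (cur : option color)
    (b rest : seq item) : state :=
  if rest is i :: rest' then
    if size b < k then
      if cur == Some (color_of sigma i) then load k sigma cur b rest'
      else load k sigma cur (rcons b i) rest'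
    else (b, rest)
  else (b, [::]).

Definition init (k : nat) (sigma : seq color) : state :=
  load k sigma None [::] (iota 0 (size sigma)).

Definition serve (k : nat) (sigma : seq color) (x : color) (st : state) :
    state :=
  load k sigma (Some x) [seq i <- st.1 | color_of sigma i != x] st.2.

(* [s] is the list of the colors chosen, each choice being permitted by
   [rule], until every item has been served. *)
Fixpoint run (k : nat) (sigma : seq color) (rule : state -> color -> bool)
    (st : state) (s : seq color) : bool :=
  if s is x :: s' then rule st x && run k sigma rule (serve k sigma x st) s'
  else st == ([::], [::]).

Definition available (sigma : seq color) (st : state) (x : color) : bool :=
  x \in [seq color_of sigma i | i <- st.1].

Definition schedule (k : nat) (sigma s : seq color) : bool :=
  run k sigma (available sigma) (init k sigma) s.

(* Since the initial buffer has no color and a served color leaves the buffer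
   (see [schedule_changes]), every choice is a color change. *)
Definition cost (s : seq color) : nat := size s.

Definition is_opt (k : nat) (sigma : seq color) (m : nat) : Prop :=
  (exists2 s, schedule k sigma s & cost s = m) /\
  (forall s, schedule k sigma s -> m <= cost s).

(* For [i < size sigma], the position of the next item of the color of [i]; it
   is [size sigma], which is beyond every position and stands for infinity,
   when there is no such item. *)
Definition next_occ (sigma : seq color) (i : item) : nat :=
  i.+1 + index (color_of sigma i) (drop i.+1 sigma).

(* "Farthest" refers to the position of the next occurrence.  Finite positions
   are pairwise distinct, so ties occur only at infinity; they may be broken in
   any way, hence the possibly several LFD schedules. *)
Definition lfd_choice (sigma : seq color) (st : state) (x : color) : bool :=
  has (fun i => (color_of sigma i == x) &&
         all (fun j => next_occ sigma j <= next_occ sigma i) st.1) st.1.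

Definition lfd_schedule (k : nat) (sigma s : seq color) : bool :=
  run k sigma (lfd_choice sigma) (init k sigma) s.

Lemma lfd_choice_available sigma st x :
  lfd_choice sigma st x -> available sigma st x.
Proof. by case/hasP=> i ib /andP[/eqP <- _]; apply: map_f. Qed.

Lemma lfd_scheduleW k sigma s : lfd_schedule k sigma s -> schedule k sigma s.
Proof.
rewrite /lfd_schedule /schedule; elim: s (init k sigma) => [|x s IHs] st //=.
by case/andP=> /lfd_choice_available-> /IHs.
Qed.

Lemma load_notin k sigma x b rest :
  x \notin [seq color_of sigma i | i <- b] ->
  x \notin [seq color_of sigma i | i <- (load k sigma (Some x) b rest).1].
Proof.
elim: rest b => [|i rest IH] b //= xb; case: ifP => // _.
case: eqP => [_|ne]; first exact: IH.
apply: IH; rewrite map_rcons mem_rcons inE negb_or xb andbT.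
by apply/eqP => e; apply: ne; rewrite e.
Qed.

Lemma schedule_changes k sigma s :
  schedule k sigma s -> sorted (fun x y => x != y) s.
Proof.
rewrite /schedule; case: s (init k sigma) => [|x s] st //= /andP[_].
elim: s x st => [|y s IH] x st //= /andP[ya hs].
rewrite (IH _ _ hs) andbT; apply: contraTneq ya => <-.
apply: load_notin; apply/negP => /mapP[i].
by rewrite mem_filter => /andP[/eqP ne _] e; apply: ne.
Qed.

Lemma load_size k sigma cur b rest :
  size (load k sigma cur b rest).1 + size (load k sigma cur b rest).2
    <= size b + size rest.
Proof.
elim: rest b => [|i rest IH] b //=; case: ifP => // _.
case: ifP => _; apply: leq_trans (IH _) _; last by rewrite size_rcons addSnnS.
by rewrite leq_add2l.
Qed.

Lemma load_nil k sigma cur b rest : 0 < k ->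
  (load k sigma cur b rest).1 = [::] -> (load k sigma cur b rest).2 = [::].
Proof.
move=> k0; elim: rest b => [|i rest IH] b //=; case: ifP => [_|].
  by case: ifP => _; apply: IH.
by move=> + /= b0; rewrite b0 k0.
Qed.

Lemma lfd_choice_ex sigma st : st.1 != [::] -> exists x, lfd_choice sigma st x.
Proof.
move=> b0.
have [i ib imax]: exists2 i, i \in st.1 &
    forall j, j \in st.1 -> next_occ sigma j <= next_occ sigma i.
  elim: st.1 b0 => [|a [|a' b] IH] // _.
    by exists a; rewrite ?inE // => j; rewrite inE => /eqP->.
  have [//|i ib imax] := IH.
  case: (leqP (next_occ sigma a) (next_occ sigma i)) => h.
    exists i; first by rewrite in_cons ib orbT.
    by move=> j; rewrite in_cons => /predU1P[->//|/imax].
  exists a; first by rewrite inE eqxx.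
  by move=> j; rewrite in_cons => /predU1P[->//|/imax/leq_trans]; apply; apply: ltnW.
exists (color_of sigma i); apply/hasP; exists i => //; rewrite eqxx /=.
exact/allP.
Qed.

Lemma lfd_schedule_ex k sigma : 0 < k -> exists s, lfd_schedule k sigma s.
Proof.
move=> k0; rewrite /lfd_schedule.
have : (init k sigma).1 = [::] -> (init k sigma).2 = [::] by apply: load_nil.
move: (init k sigma) => st.
have [n] := ubnP (size st.1 + size st.2); elim: n st => // n IH st lt_n nil_st.
have [b0|b0] := eqVneq st.1 [::].
  by exists [::]; case: st b0 nil_st {lt_n} => b r /= -> ->.
have [x lx] := lfd_choice_ex sigma b0.
have [||s hs] := IH (serve k sigma x st); last by exists (x :: s); rewrite /= lx.
- apply: leq_ltn_trans (load_size _ _ _ _ _) _; rewrite -ltnS; apply: leq_trans _ lt_n.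
  rewrite ltnS -addSn leq_add2r size_filter.
  rewrite -(count_predC (fun i => color_of sigma i != x) st.1) -addn1 leq_add2l.
  rewrite -has_count; have /mapP[i ib ->] := lfd_choice_available lx.
  by apply/hasP; exists i => //=; rewrite eqxx.
- exact: load_nil.
Qed.

Lemma is_opt_ex k sigma : 0 < k -> exists m, is_opt k sigma m.
Proof.
move=> k0; have [s0 /lfd_scheduleW hs0] := lfd_schedule_ex sigma k0.
have [n] := ubnP (size s0); elim: n s0 hs0 => // n IH s0 hs0 lt_n.
have [[s hs lt_s]|h] :=
    boolp.pselect (exists2 s, schedule k sigma s & size s < size s0).
  by apply: (IH s hs); apply: leq_trans lt_s _.
exists (size s0); split; first by exists s0.
by move=> s hs; rewrite leqNgt; apply/negP => lt_s; apply: h; exists s.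
Qed.

(* Main.v *)
(** Let color 0 fill all but [t] slots of the buffer, and let the rest of the
    input be [x_t^t 0 x_(t-1)^(t-1) 0 ... x_1 0], where the colors [x_f]
    alternate between 1 and 2.  When LFD has to choose, the buffer holds items
    of color 0 and a full block [x_f^f]; the next 0 comes right after that
    block, so LFD always serves [x_f], and the freed slots are taken by one more
    0 and the block [x_(f-1)^(f-1)].  Hence LFD pays for every one of the [t]
    blocks.  Serving color 0 first instead makes room for all the blocks, at
    most [t ^ 2] items, so that three color changes suffice if [t ^ 2 < k].
    The smallest such [k] would give a ratio of order [k ^ (1/2)]; the choice
    [k = t ^ 3] is enough here and avoids rounding. *)
Require Import Defs.
From mathcomp Require Import all_boot all_order all_algebra.
From mathcomp Require Import all_reals all_analysis.
From mathcomp Require Import zify.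
Import Order.TTheory GRing.Theory Num.Theory.

Set Implicit Arguments.
Unset Strict Implicit.
Unset Printing Implicit Defensive.

(** * Loading the buffer and next occurrences *)

Lemma load_full k sigma cur b r : k <= size b -> load k sigma cur b r = (b, r).
Proof. by case: r => [|i r] //= kb; rewrite ltnNge kb. Qed.

Lemma load_cat k sigma cur b l r :
  all (fun i => cur != Some (color_of sigma i)) l -> size b + size l <= k ->
  load k sigma cur b (l ++ r) = load k sigma cur (b ++ l) r.
Proof.
elim: l b => [|i l IH] b /=; first by rewrite cats0.
case/andP=> /negbTE ci cl le_k; rewrite ci ifT; last by lia.
by rewrite IH ?size_rcons ?cat_rcons //; lia.
Qed.

(** The bound is strict because [load] stops as soon as the buffer is full, even if the next item
    has the active color. *)
Lemma load_all k sigma x b r :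
  size b + size [seq i <- r | color_of sigma i != x] < k ->
  load k sigma (Some x) b r =
    (b ++ [seq i <- r | color_of sigma i != x], [::]).
Proof.
elim: r b => [|i r IH] b /=; first by rewrite cats0.
have -> : (Some x == Some (color_of sigma i)) = (color_of sigma i == x).
  by rewrite eq_sym.
case: eqP => _ /= lt_k; rewrite ifT; try by lia.
  exact: IH.
by rewrite IH ?size_rcons ?cat_rcons //; lia.
Qed.

Lemma init_iota k sigma : k <= size sigma ->
  init k sigma = (iota 0 k, iota k (size sigma - k)).
Proof.
move=> le_k; rewrite /init -{1}(subnKC le_k) iotaD load_cat ?size_iota //.
  by rewrite load_full // size_iota.
by apply/allP.
Qed.

Lemma map_color_of_filter sigma (P : pred color) :
  [seq color_of sigma i | i <- iota 0 (size sigma) & P (color_of sigma i)] =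
    [seq x <- sigma | P x].
Proof. by rewrite -filter_map -/(mkseq (nth 0 sigma) _) mkseq_nth. Qed.

Lemma next_occ_le sigma i j :
  i < j < size sigma -> color_of sigma i = color_of sigma j ->
  next_occ sigma i <= j.
Proof.
case/andP=> lt_ij lt_j eq_c; rewrite /next_occ.
suff: index (color_of sigma i) (drop i.+1 sigma) <= j - i.+1 by lia.
have -> : color_of sigma i = nth 0 (drop i.+1 sigma) (j - i.+1).
  by rewrite nth_drop subnKC.
rewrite leqNgt; apply/negP => /(before_find 0).
by rewrite /= eqxx.
Qed.

Lemma next_occ_gt sigma i : i.+1 < size sigma ->
  color_of sigma i.+1 != color_of sigma i -> i.+1 < next_occ sigma i.
Proof.
by move=> lt_i /negbTE ne; rewrite /next_occ (drop_nth 0 lt_i) /= ne; lia.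
Qed.

(** * The block sequence *)

(** Neighboring blocks must differ in color, or serving one would sweep away the next; the values 1
    and 2 avoid the filler color 0. *)
Definition alt (f : nat) : color := (odd f).+1.

Fixpoint blocks (f : nat) : seq color :=
  if f is f'.+1 then nseq f (alt f) ++ 0 :: blocks f' else [::].

Lemma blocksS f :
  blocks f.+1 = nseq f.+1 (alt f.+1) ++ 0 :: blocks f.
Proof. by []. Qed.

Lemma size_blocks f : f <= size (blocks f).
Proof. by case: f => [|f] //; rewrite blocksS size_cat size_nseq leq_addr. Qed.

Lemma count_blocks f : count (predC1 0) (blocks f) <= f ^ 2.
Proof.
elim: f => [|f IH] //.
rewrite blocksS count_cat count_nseq.
rewrite /= mul1n add0n; apply: leq_trans (leq_add (leqnn _) IH) _; nia.
Qed.

Lemma blocks_lt3 f : all (fun x => x < 3) (blocks f).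
Proof.
elim: f => [|f IH] //; rewrite blocksS all_cat all_nseq /= IH andbT.
by rewrite /alt; case: odd.
Qed.

Lemma mem_blocks f t : 0 < f <= t -> alt f \in blocks t.
Proof.
elim: t => [|t IH] hf; first by lia.
rewrite blocksS mem_cat mem_nseq.
rewrite in_cons; case: (eqVneq f t.+1) => [->|ne]; first by rewrite eqxx.
by rewrite IH ?orbT //; lia.
Qed.

Lemma color_block pre f i : size pre <= i < size pre + f ->
  color_of (pre ++ blocks f) i = alt f.
Proof.
case/andP=> le_i lt_i.
case: f lt_i => [|f] lt_i; first by rewrite addn0 ltnNge le_i in lt_i.
rewrite /color_of nth_cat ltnNge le_i blocksS nth_cat size_nseq nth_nseq.
by rewrite ltn_subLR // lt_i.
Qed.

Lemma color_sep pre f :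
  color_of (pre ++ blocks f.+1) (size pre + f.+1) = 0.
Proof.
rewrite /color_of blocksS nth_cat ltnNge leq_addr addKn nth_cat size_nseq.
by rewrite ltnn subnn.
Qed.

(** * LFD on the blocks *)

Section BlockStep.

Variables (k f : nat) (pre : seq color) (zeros : seq item).
Let sigma := pre ++ blocks f.+1.
Let p := size pre.
Hypothesis zerosP : all (fun i => (i < p) && (color_of sigma i == 0)) zeros.

(** The situation at each choice of LFD: a whole block is buffered, and its separator 0 at
    [p + f.+1] is the first item outside. *)
Let st : state :=
  (zeros ++ iota p f.+1, iota (p + f.+1) (size sigma - (p + f.+1))).

Let size_sigma : size sigma = p + f.+1 + (size (blocks f)).+1.
Proof. by rewrite /sigma size_cat blocksS size_cat size_nseq addnA. Qed.

Let color_iota i : i \in iota p f.+1 -> color_of sigma i = alt f.+1.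
Proof. by rewrite mem_iota => hi; apply: color_block. Qed.

(** The separator caps the next occurrence of every buffered 0, while the last item of the block,
    [p + f], has its own beyond the separator. *)
Lemma lfd_choice_block x : lfd_choice sigma st x -> x = alt f.+1.
Proof.
case/hasP=> i; rewrite mem_cat => /orP[iz|ib]; last first.
  by rewrite (color_iota ib) => /andP[/eqP].
have /andP[lt_i /eqP ci] := allP zerosP _ iz.
case/andP=> _ /allP /(_ (p + f)).
rewrite mem_cat mem_iota => imax.
have {imax} : next_occ sigma (p + f) <= next_occ sigma i by apply: imax; lia.
have : next_occ sigma i <= p + f.+1.
  by apply: next_occ_le; [rewrite size_sigma; lia | rewrite ci color_sep].
have : (p + f).+1 < next_occ sigma (p + f).
  apply: next_occ_gt; first by rewrite size_sigma; lia.
  by rewrite -addnS color_sep color_iota // mem_iota; lia.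
by lia.
Qed.

(** The [f.+1] freed slots take the separator and the [f] items of the next block, none of the
    served color, so the buffer is full again. *)
Lemma serve_block : size zeros + f.+1 = k ->
  serve k sigma (alt f.+1) st =
    (rcons zeros (p + f.+1) ++ iota (p + f.+2) f,
     iota (p + f.+2 + f) (size sigma - (p + f.+2 + f))).
Proof.
move=> szk; rewrite /serve /st /= filter_cat.
have -> : [seq i <- zeros | color_of sigma i != alt f.+1] = zeros.
  by apply/all_filterP/allP => i /(allP zerosP)/andP[_ /eqP->].
have -> : [seq i <- iota p f.+1 | color_of sigma i != alt f.+1] = [::].
  apply/eqP; rewrite -[_ == _]negbK -has_filter -all_predC.
  by apply/allP => i /color_iota /= ->; rewrite eqxx.
have le_f := size_blocks f.
have -> : size sigma - (p + f.+1) = (1 + f) + (size sigma - (p + f.+2 + f)).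
  by rewrite size_sigma; lia.
rewrite cats0 iotaD load_cat ?size_iota; last by lia.
  rewrite load_full; last by rewrite size_cat size_iota; lia.
  rewrite iotaD /= -cat_rcons.
  by congr ((_ ++ iota _ _), iota _ _); lia.
rewrite /= color_sep /=; apply/allP => i; rewrite mem_iota => hi.
(* With the served block and its separator in the prefix, [color_block] applies to the next
   block. *)
have -> : sigma = (pre ++ rcons (nseq f.+1 (alt f.+1)) 0) ++ blocks f.
  by rewrite -catA cat_rcons.
rewrite color_block; first by rewrite /alt /=; case: (odd f).
by rewrite size_cat size_rcons size_nseq; lia.
Qed.

End BlockStep.

(** Induction on [f]: each choice removes one block, which then joins [pre] with its separator, so
    the input stays the same list. *)
Lemma lfd_blocks k f pre zeros s :
  let sigma := pre ++ blocks f in let p := size pre in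
  all (fun i => (i < p) && (color_of sigma i == 0)) zeros ->
  size zeros + f = k ->
  run k sigma (lfd_choice sigma)
    (zeros ++ iota p f, iota (p + f) (size sigma - (p + f))) s ->
  f <= size s.
Proof.
elim: f pre zeros s => [|f IH] pre zeros [|x s] //= zerosP szk.
  (* The run cannot stop while the buffer holds a block. *)
  by rewrite xpair_eqE; case: zeros {zerosP szk}.
case/andP=> /(lfd_choice_block zerosP) -> .
rewrite (serve_block zerosP szk) ltnS.
have e : pre ++ blocks f.+1 =
    (pre ++ rcons (nseq f.+1 (alt f.+1)) 0) ++ blocks f.
  by rewrite -catA cat_rcons.
have sp : size pre + f.+2 = size (pre ++ rcons (nseq f.+1 (alt f.+1)) 0).
  by rewrite size_cat size_rcons size_nseq.
have zerosP' : all (fun i => (i < size pre + f.+2) &&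
    (color_of (pre ++ blocks f.+1) i == 0)) (rcons zeros (size pre + f.+1)).
  rewrite all_rcons color_sep eqxx andbT ltn_add2l ltnSn /=.
  by apply: sub_all zerosP => i /andP[lt_i ->]; rewrite andbT; lia.
rewrite -[_ :: _ ++ _]/(blocks f.+1).
move: zerosP'; rewrite e sp => zerosP'; apply: IH zerosP' _.
by rewrite size_rcons; lia.
Qed.

(** * The instance and its two schedules *)

Definition instance (k t : nat) : seq color := nseq (k - t) 0 ++ blocks t.

Lemma size_instance k t : t <= k -> k <= size (instance k t).
Proof. by move=> tk; rewrite size_cat size_nseq; have := size_blocks t; lia. Qed.

Lemma lfd_instance k t s : t <= k ->
  lfd_schedule k (instance k t) s -> t <= cost s.
Proof.
move=> tk; rewrite /lfd_schedule init_iota ?size_instance // => hs.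
apply: (@lfd_blocks k t (nseq (k - t) 0) (iota 0 (k - t))).
- apply/allP => i; rewrite mem_iota size_nseq => hi.
  by rewrite /color_of nth_cat size_nseq nth_nseq ifT ?ifT ?eqxx ?andbT; lia.
- by rewrite size_iota subnK.
- rewrite size_nseq -{1}(add0n (k - t)) -iotaD subnK //.
Qed.

(** After color 0 is served, the at most [t ^ 2] other items all fit and the input is exhausted. The
    condition [1 < t] makes colors 1 and 2 both occur, so that each is available. *)
Lemma schedule_instance k t : 1 < t -> t ^ 2 < k ->
  schedule k (instance k t) [:: 0; 1; 2].
Proof.
move=> t1 tk; have lt_tk : t < k by nia.
set sigma := instance k t.
have le_k : k <= size sigma by apply: size_instance; lia.
have lt3 i : color_of sigma i < 3.
  case: (ltnP i (size sigma)) => [hi|hi]; last by rewrite /color_of nth_default.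
  suff /allP: all (fun x => x < 3) sigma by apply; apply: mem_nth.
  by rewrite all_cat all_nseq blocks_lt3 orbT.
set nz := [seq i <- iota 0 (size sigma) | color_of sigma i != 0].
have e0 : serve k sigma 0 (init k sigma) = (nz, [::]).
  rewrite init_iota // /serve /= load_all -?filter_cat -?size_cat.
    by rewrite -iotaD subnKC.
  rewrite -filter_cat -iotaD subnKC // -(size_map (color_of sigma)).
  rewrite (map_color_of_filter _ (predC1 0)) size_filter.
  rewrite count_cat count_nseq /= mul0n.
  exact: leq_ltn_trans (count_blocks t) tk.
have nzP c : 0 < c < 3 -> exists2 i, i \in nz & color_of sigma i = c.
  move=> hc.
  suff /mapP[i iz ->]: c \in [seq color_of sigma i | i <- nz] by exists i.
  rewrite (map_color_of_filter _ (predC1 0)) mem_filter /= -lt0n mem_cat.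
  case: c hc => [|[|[|c]]] // _; apply/orP; right.
  (* Here [alt 2] is 1 and [alt 1] is 2. *)
  - exact: (@mem_blocks 2).
  - by apply: (@mem_blocks 1); apply: ltnW.
have nz0 i : i \in nz -> color_of sigma i != 0 by rewrite mem_filter => /andP[].
have [i1 i1z c1] := nzP 1 isT; have [i2 i2z c2] := nzP 2 isT.
rewrite /schedule /= e0 /serve /= /available; apply/and4P; split.
- rewrite init_iota //; apply/mapP; exists 0; first by rewrite mem_iota; lia.
  by rewrite /color_of /sigma /instance nth_cat size_nseq nth_nseq subn_gt0 lt_tk.
- by rewrite -c1 map_f.
- by rewrite -c2 map_f // mem_filter c2.
- rewrite -filter_predI; apply/eqP; congr pair; apply/eqP.
  rewrite -[_ == _]negbK -has_filter -all_predC; apply/allP => i /nz0 /=.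
  by case: (color_of sigma i) (lt3 i) => [|[|[|]]].
Qed.

Local Open Scope ring_scope.

Theorem theorem5 (R : realType) :
  exists2 c : R, 0 < c &
    forall K : nat, exists k : nat, (K <= k)%N /\
      exists (sigma : seq color) (opt : nat),
        [/\ is_opt k sigma opt, (0 < opt)%N &
          forall s : seq color, lfd_schedule k sigma s ->
            c * (k%:R `^ 3^-1) * opt%:R <= (cost s)%:R].
Proof.
(* LFD pays at least [t], the cube root of the buffer size, and the optimum is at most 3. *)
exists 3^-1; first by rewrite invr_gt0.
(* This [t] gives both [1 < t] and [K <= t ^ 3]. *)
move=> K; pose t := K.+2; exists (t ^ 3)%N.
have t2k : (t ^ 2 < t ^ 3)%N by rewrite ltn_exp2l.
have tk : (t <= t ^ 3)%N by rewrite -{1}(expn1 t) leq_exp2l.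
split; first by rewrite (leq_trans _ tk) // /t; lia.
have [|opt optP] := @is_opt_ex (t ^ 3) (instance (t ^ 3) t); first by lia.
have opt3 : (opt <= 3)%N.
  by case: optP => _ /(_ [:: 0; 1; 2]%N); apply; apply: schedule_instance.
exists (instance (t ^ 3) t), opt; split=> // [|s /(lfd_instance tk) ts].
  (* The initial buffer is nonempty, so the empty list is not a schedule. *)
  case: optP => -[[|x s] // + <-] _ //.
  by rewrite /schedule init_iota ?size_instance.
have -> : (t ^ 3)%:R `^ 3^-1 = t%:R :> R.
  by rewrite natrX -powR_mulrn // -powRrM mulfV ?powRr1 // pnatr_eq0.
rewrite mulrAC -mulrA ler_pdivrMl // -!natrM ler_nat; nia.
Qed.
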